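(* Let $r\ge 4$ be an even integer such that $r+2$ is not a perfect square. Then, for every $n$ and every rank-$r$ orthogonal projection $Q\in\mathbb{R}^{n\times n}$, $$\|Q\|_1\le\left(\frac{r+\sqrt{r+2}}{1+\sqrt{r+2}}-\frac{r}{2(2r)^{4r+8}}\right)n.$$ Consequently, $$\gamma(r)\le\frac{r+\sqrt{r+2}}{1+\sqrt{r+2}}-\frac{r}{2(2r)^{4r+8}}.$$
   Context: A rank-$r$ orthogonal projection is a real matrix $Q$ with $Q=Q^\top=Q^2$ and $\operatorname{rank}(Q)=r$; $\|Q\|_1:=\sum_{i,j}|q_{ij}|$ is the entrywise $\ell_1$-norm. For integers $N\ge r\ge1$, let $\mathcal{P}_r(N)$ be the set of rank-$r$ orthogonal projections in $\mathbb{R}^{N\times N}$, let $\gamma(N,r):=\frac1N\max_{Q\in\mathcal{P}_r(N)}\|Q\|_1$, and let $\gamma(r):=\sup_{N\ge r}\gamma(N,r)$. *)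

(* Defs.v *)
From HB Require Import structures.
From mathcomp Require Import all_boot all_order all_algebra.
From mathcomp Require Import boolp classical_sets reals constructive_ereal ereal.
Set Implicit Arguments.
Unset Strict Implicit.
Unset Printing Implicit Defensive.

Import Order.TTheory GRing.Theory Num.Theory.
Local Open Scope classical_set_scope.
Local Open Scope ring_scope.

Definition l1norm (R : realType) (m n : nat) (A : 'M[R]_(m, n)) : R :=
  \sum_i \sum_j `|A i j|.

Definition orthoproj (R : realType) (r N : nat) : set 'M[R]_N :=
  [set Q | [/\ Q = Q^T, Q = Q *m Q & \rank Q = r]].
Arguments orthoproj : clear implicits.

(* The maximum of the l1-norm over the (compact) set of rank-r projections and
   the supremum over N are both taken in \bar R: unlike [sup] on R, [ereal_sup]
   has no default value on unbounded sets, so no side condition is hidden. For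
   1 <= r <= N the set of projections is nonempty and N is nonzero. *)
Definition gammaNr (R : realType) (N r : nat) : \bar R :=
  ((N%:R^-1)%:E * ereal_sup [set (l1norm Q)%:E | Q in orthoproj R r N])%E.
Arguments gammaNr : clear implicits.

Definition gamma (R : realType) (r : nat) : \bar R :=
  ereal_sup [set gammaNr R N r | N in [set N | (r <= N)%N]].
Arguments gamma : clear implicits.

(* Main.v *)
Require Import Defs.
From HB Require Import structures.
From mathcomp Require Import all_boot all_order all_fingroup all_algebra.
From mathcomp Require Import boolp classical_sets reals constructive_ereal ereal.
From mathcomp Require Import zify ring lra.
Set Implicit Arguments.
Unset Strict Implicit.
Unset Printing Implicit Defensive.

Import Order.TTheory GRing.Theory Num.Theory.
Local Open Scope ring_scope.

(** Let Q be a projection of rank r, and set Q_ij = a_i a_j t_ij with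
    a_i = sqrt (Q_ii), so that the t_ij are the cosines of the angles between the
    vectors of a tight frame in dimension r.  The norm of Q is the first absolute
    moment of the t_ij for the weights a_i a_j.  With c = 1 / sqrt (r + 2), the
    absolute value of t is bounded on [-1, 1] by an even polynomial of degree 4 in
    t, with a negative leading coefficient and with equality exactly at
    |t| = c and |t| = 1 ([defectE], [defect_ge0]).  The second moment is at most n
    ([proj_second_moment]), the fourth moment is at least 3 / (r (r + 2)) times
    the square of the sum of the a_i ([proj_fourth_moment]), and this square is at
    most n r.  Together these yield the bound without the gap.

    If the gap is violated, then all these inequalities are nearly equalities
    ([near_extremal_estimates]).  Hence the weighted proportion of the pairs (i, j)
    for which |t_ij| is not within eta = 1 / (2 r^(2r+4)) of c is less than 1 / r:
    most of them have |t_ij| near 1, and their proportion, close to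
    2 / (r (r + 1)), is controlled by the second moment ([off_angle_le],
    [off_angle_weight_lt]).  A weighted theorem of Turan ([weighted_turan]) then
    provides r + 1 indices for which every |t_ij| with i <> j is within eta of c.

    The Gram matrix of these r + 1 vectors of a space of dimension r is singular.
    On the other hand it is close to I + c S, where S is a symmetric matrix of odd
    order r + 1 with zero diagonal and all other entries 1 or -1.  Modulo 2 the
    characteristic polynomial of S is X (X + 1)^r, and therefore its value at
    sqrt (r + 2) has the form p + q sqrt (r + 2) with q odd; as r + 2 is not a
    square, the integer det (S^2 - (r + 2) I) is nonzero
    ([sign_char_poly_norm]).  This makes the Gram matrix invertible
    ([near_equiangular_det_neq0]), a contradiction. *)

(** * A weighted theorem of Turan *)

(** Weighted form of the theorem of Turan (Motzkin and Straus): if k times the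
    weight of the pairs related by [bad] is less than the weight of all pairs, a
    pair being weighted by the product of the weights of its members, then there
    are k + 1 points no two of which are related. *)
Lemma weighted_turan (R : realFieldType) (T : finType) (w : T -> R)
    (bad : rel T) :
  (forall i, 0 <= w i) -> reflexive bad -> symmetric bad ->
  forall (k : nat) (P : {set T}),
  0 < \sum_(i in P) w i ->
  k%:R * (\sum_(i in P) \sum_(j in P | bad i j) w i * w j)
    < (\sum_(i in P) w i) ^+ 2 ->
  exists C : {set T}, [/\ C \subset P, #|C| = k.+1 &
    {in C &, forall i j, i != j -> ~~ bad i j}].
Proof.
move=> w_ge0 badxx badC; elim=> [|k IHk] P W_gt0 BW.
  have [i iP|P0] := pickP (mem P); last first.
    by move: W_gt0; rewrite big_pred0 ?ltxx.
  exists [set i]; split; rewrite ?cards1 ?finset.sub1set //.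
  by move=> x y /set1P-> /set1P->; rewrite eqxx.
have [i0 i0P|P0] := pickP (mem P); last first.
  by move: W_gt0; rewrite big_pred0 ?ltxx.
pose d i := \sum_(j in P | bad i j) w j.
(* Keep a point v of least bad degree d v, and discard all that is bad to v. *)
have [v vP v_min] : exists2 v, v \in P & forall i, i \in P -> d v <= d i.
  by case: (Order.TotalTheory.arg_minP d i0P) => v vP vm; exists v.
pose N := P :&: [set j | bad v j]; pose P' := P :\: [set j | bad v j].
set W := \sum_(i in P) w i in W_gt0 BW *.
set B := \sum_(i in P) _ in BW *.
have BE : B = \sum_(i in P) w i * d i.
  by apply: eq_bigr => i _; rewrite mulr_sumr.
have WE : W = d v + \sum_(i in P') w i.
  rewrite /W (big_setID [set j | bad v j]) /=; congr (_ + _).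
  by apply: eq_bigl => j; rewrite !inE.
have d_ge0 i : 0 <= d i by apply: sumr_ge0.
have leB : d v * W <= B.
  rewrite BE mulr_sumr; apply: ler_sum => i iP.
  by rewrite mulrC ler_wpM2l ?v_min.
have B_split : B = \sum_(i in N) w i * d i + \sum_(i in P') w i * d i.
  by rewrite BE (big_setID [set j | bad v j]).
have leN : d v * d v <= \sum_(i in N) w i * d i.
  rewrite {2}/d mulr_sumr [leRHS](eq_bigl (fun j => (j \in P) && bad v j)).
    by apply: ler_sum => i /andP[iP _]; rewrite mulrC ler_wpM2l ?v_min.
  by move=> j; rewrite !inE.
set B' := \sum_(i in P') \sum_(j in P' | bad i j) w i * w j.
have leB' : B' <= B - d v * d v.
  have : B' <= \sum_(i in P') w i * d i; last by lra.
  apply: ler_sum => i _; rewrite /d mulr_sumr.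
  rewrite big_mkcondr [leRHS]big_mkcondr /= [leRHS](big_setID [set j | bad v j]) /=.
  rewrite lerDr; apply: sumr_ge0 => j _; case: ifP => // _.
  exact: mulr_ge0.
have dvW : d v < W.
  rewrite ltNge; apply/negP => leWd.
  have : W * W <= B by apply: le_trans leB; rewrite ler_pM2r.
  have : B <= k.+1%:R * B.
    by rewrite ler_peMl ?ler1n //; apply: le_trans leB; rewrite mulr_ge0 // ltW.
  by move: BW; rewrite expr2; lra.
set W' := \sum_(i in P') w i in WE *.
have W'_gt0 : 0 < W' by lra.
have kB' : k%:R * B' < W' ^+ 2.
  have [->|k_gt0] := posnP k; first by rewrite mul0r exprn_gt0.
  have kp : 0 < k%:R :> R by rewrite ltr0n.
  apply: (@le_lt_trans _ _ (k%:R * (B - d v * d v))); first by rewrite ler_pM2l.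
  rewrite -(@ltr_pM2l _ k.+1%:R) ?ltr0n //.
  apply: (@lt_le_trans _ _ (k%:R * W ^+ 2 - k%:R * k.+1%:R * (d v * d v))).
    have : k%:R * (k.+1%:R * B) < k%:R * W ^+ 2 by rewrite ltr_pM2l.
    by lra.
  (* The difference is the square of W' - k d v, which vanishes in the extremal
     case of k + 1 classes of equal weight. *)
  rewrite -subr_ge0 WE.
  rewrite (_ : _ - _ = (W' - k%:R * d v) ^+ 2) ?sqr_ge0 //.
  by rewrite -[k.+1]addn1 natrD; ring.
have [C [sCP cC goodC]] := IHk _ W'_gt0 kB'.
exists (v |: C); split.
- by rewrite finset.subUset finset.sub1set vP (fintype.subset_trans sCP) ?finset.subsetDl.
- rewrite cardsU1 cC; case: (boolP (v \in C)) => // /(fintype.subsetP sCP).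
  by rewrite !inE badxx.
- have far j : j \in C -> ~~ bad v j.
    by move/(fintype.subsetP sCP); rewrite !inE => /andP[].
  move=> i j /setU1P[->|iC] /setU1P[->|jC]; rewrite ?eqxx //.
  + by move=> _; apply: far.
  + by move=> _; rewrite badC; apply: far.
  + exact: goodC.
Qed.

(** * Sign matrices of odd order *)

(** Determinant of a rank-one perturbation of a scalar matrix, in a form free of
    division. *)
Lemma det_scalar_add_mul (R : idomainType) (n : nat) (a : R)
    (u : 'cV[R]_n) (v : 'rV[R]_n) : a != 0 ->
  \det (a%:M + u *m v) * a = a ^+ n * (a + (v *m u) 0 0).
Proof.
move=> a0.
pose X : 'M_(1 + n) := block_mx 1%:M (- v) u a%:M.
have E1 : X = block_mx 1%:M 0 u 1%:M *m block_mx 1%:M (- v) 0 (a%:M + u *m v).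
  rewrite mulmx_block !mul1mx !mul0mx !mulmx1 !addr0.
  by rewrite mulmxN addrCA addNr addr0.
have E2 : X *m block_mx a%:M 0 (- u) 1%:M =
          block_mx (a%:M + v *m u) (- v) 0 a%:M.
  rewrite mulmx_block !mul1mx !mulmx1 !mulmx0 !add0r mulmxN mulNmx opprK.
  by rewrite mulmxN mul_mx_scalar mul_scalar_mx subrr.
have D1 : \det X = \det (a%:M + u *m v).
  by rewrite E1 det_mulmx det_lblock det_ublock !det1 !mul1r.
have := congr1 determinant E2.
rewrite det_mulmx D1 det_lblock det_ublock det1 mulr1 !det_scalar expr1 => ->.
by rewrite det_mx11 mxE mxE eqxx mulr1n mulrC.
Qed.

(** For a matrix of odd order with zero diagonal and all other entries equal to
    1 or -1, the coefficient of X in the characteristic polynomial is odd: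
    modulo 2 the matrix is J + I, with J the all-ones matrix, and its
    characteristic polynomial is X (X + 1)^n. *)
Lemma sign_char_poly_coef1 (n : nat) (S : 'M[int]_n.+1) :
  ~~ odd n ->
  (forall i j, i != j -> S i j = 1 \/ S i j = -1) -> (forall i, S i i = 0) ->
  ((char_poly S)`_1)%:~R = 1 :> 'F_2.
Proof.
move=> n_even Sij Sii.
have F2 : (2%:R : 'F_2) = 0 by exact/val_inj.
have oppF (x : 'F_2) : - x = x.
  by apply/eqP; rewrite -subr_eq0 -opprD oppr_eq0 -mulr2n -mulr_natl F2 mul0r.
rewrite -coef_map map_char_poly.
pose a : {poly 'F_2} := 'X + 1.
have a0 : a != 0 by rewrite /a -polyC1 monic_neq0 ?monicXaddC.
have -> : char_poly (map_mx intr S : 'M['F_2]_n.+1) =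
    \det (a%:M + (const_mx 1 : 'cV_n.+1) *m (const_mx 1 : 'rV_n.+1)).
  rewrite /char_poly; congr (\det _); apply/matrixP=> i j.
  rewrite !mxE big_ord1 !mxE mulr1.
  have [<-|ij] := eqVneq i j.
    rewrite Sii subr0 !mulr1n /a -addrA -polyC1 -polyCD.
    by rewrite (_ : 1 + 1 = 0 :> 'F_2) ?addr0 //; exact/val_inj.
  rewrite !mulr0n sub0r add0r.
  by case: (Sij _ _ ij) => ->; rewrite ?rmorphN1 ?rmorph1 -!polyCN !oppF.
have := det_scalar_add_mul (const_mx 1 : 'cV_n.+1) (const_mx 1 : 'rV_n.+1) a0.
rewrite mxE (eq_bigr (fun=> 1)) => [|j _]; last by rewrite !mxE mulr1.
rewrite sumr_const card_ord exprSr mulrAC => /(mulIf a0) ->.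
have P2 : 2%:R = 0 :> {poly 'F_2} by rewrite -polyC_natr F2 polyC0.
have -> : a + n.+1%:R = 'X.
  rewrite -[n.+1]/(1 + n)%N -[n]odd_double_half (negPf n_even) add0n -muln2.
  by rewrite natrD natrM P2 mulr0 addr0 -addrA -mulr2n P2 addr0.
by rewrite coefMX /= -horner_coef0 horner_exp !hornerE expr1n.
Qed.

Lemma sqr_sub_nonsquare_neq0 (m : nat) (p q : int) :
  (forall k : nat, m <> (k ^ 2)%N) -> q != 0 -> p ^+ 2 - m%:Z * q ^+ 2 != 0.
Proof.
move=> m_nsq q0; apply/eqP=> /eqP; rewrite subr_eq0 => /eqP/(congr1 absz).
rewrite abszM !abszX absz_nat => pq.
have : (`|q| ^ 2 %| `|p| ^ 2)%N by rewrite pq dvdn_mull.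
rewrite dvdn_pexp2r // => /dvdnP[k pk].
apply: (m_nsq k); apply/eqP; rewrite -(@eqn_pmul2r (`|q| ^ 2)) -?pq ?pk ?expnMn //.
by rewrite expn_gt0 absz_gt0 q0.
Qed.

(** The determinant of S^2 - m I is, up to sign, the product f(s) f(-s), where f
    is the characteristic polynomial of S and s^2 = m.  Writing
    f = p(X^2) + X q(X^2), it is the integer p(m)^2 - m q(m)^2.  As m is even,
    q(m) has the parity of the coefficient of X in f, hence is odd, and the
    integer does not vanish because m is not a square. *)
Lemma sign_char_poly_norm (R : rcfType) (n m : nat) (S : 'M[int]_n.+1) (s : R) :
  ~~ odd n -> ~~ odd m -> (forall k : nat, m <> (k ^ 2)%N) ->
  (forall i j, i != j -> S i j = 1 \/ S i j = -1) -> (forall i, S i i = 0) ->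
  s ^+ 2 = m%:R ->
  1 <= `|\det (map_mx intr S *m map_mx intr S - (m%:R)%:M : 'M[R]_n.+1)|.
Proof.
move=> n_even m_even m_nsq Sij Sii s2.
set A : 'M[R]_n.+1 := map_mx intr S.
pose f := char_poly S.
pose p := (even_poly f).[m%:Z]; pose q := (odd_poly f).[m%:Z].
have q0 : q != 0.
  apply/negP => /eqP q0.
  have := sign_char_poly_coef1 n_even Sij Sii.
  rewrite -[1%N]/(0.*2.+1)%N -coef_odd_poly -coef_map -horner_coef0 /=.
  have m0 : (m%:Z)%:~R = 0 :> 'F_2.
    rewrite -[m in LHS]odd_double_half (negPf m_even) add0n -muln2.
    by rewrite PoszM rmorphM /= (_ : 2%:~R = 0) ?mulr0 //; exact/val_inj.
  by rewrite -{1}m0 horner_map -/q q0 rmorph0 => /esym/eqP; rewrite oner_eq0.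
have fE (t : R) : t ^+ 2 = m%:R ->
    \det (t%:M - A) = p%:~R + q%:~R * t.
  move=> t2.
  have -> : \det (t%:M - A) = (map_poly intr f).[t].
    rewrite /f map_char_poly -/A /char_poly -horner_evalE -det_map_mx.
    congr (\det _); apply/matrixP=> i j; rewrite !mxE /= /horner_eval !hornerE.
    by rewrite hornerMn hornerX.
  rewrite -[f]poly_even_odd rmorphD rmorphM /= map_polyX !map_comp_poly /=.
  rewrite !map_polyXn !hornerE !horner_comp !hornerE t2.
  by rewrite -[m%:R]/((m%:Z)%:~R) !horner_map.
have -> : A *m A - (m%:R)%:M = (s%:M - A) *m ((- s)%:M - A).
  rewrite mulmxBl !mulmxBr -!scalar_mxM mul_scalar_mx mul_mx_scalar.
  by rewrite mulrN -expr2 s2 scaleNr raddfN opprB opprK addrCA subrK.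
rewrite det_mulmx !fE ?sqrrN //.
have -> : (p%:~R + q%:~R * s) * (p%:~R + q%:~R * - s) = (p ^+ 2 - m%:Z * q ^+ 2)%:~R :> R.
  rewrite -[m%:R]/((m%:Z)%:~R) in s2.
  by rewrite !expr2 rmorphB !rmorphM /= -s2; ring.
rewrite -intr_norm ler1z -gtz0_ge1 normr_gt0.
exact: sqr_sub_nonsquare_neq0.
Qed.

(** * Nearly equiangular Gram matrices *)

Lemma norm_det_le_fact (R : numDomainType) (n : nat) (A : 'M[R]_n) (b : R) :
  (forall i j, `|A i j| <= b) -> `|\det A| <= n`!%:R * b ^+ n.
Proof.
move=> Ab; apply: le_trans (ler_norm_sum _ _ _) _.
apply: le_trans (_ : \sum_(s : 'S_n) b ^+ n <= _); last first.
  by rewrite sumr_const card_Sn mulr_natl.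
apply: ler_sum => s _; rewrite normrM normr_prod normrX normrN1 expr1n mul1r.
rewrite -[n in leRHS]card_ord -prodr_const.
by apply: ler_prod => i _; rewrite normr_ge0 Ab.
Qed.

Lemma norm_mulmx_row_le (R : numDomainType) (m n : nat) (v : 'rV[R]_m)
    (A : 'M[R]_(m, n)) (x b : R) :
  (forall i, `|v 0 i| <= x) -> (forall j, \sum_i `|A i j| <= b) -> 0 <= x ->
  forall j, `|(v *m A) 0 j| <= x * b.
Proof.
move=> vx Ab x0 j; rewrite mxE; apply: le_trans (ler_norm_sum _ _ _) _.
apply: le_trans (ler_wpM2l x0 (Ab j)); rewrite mulr_sumr.
by apply: ler_sum => i _; rewrite normrM ler_wpM2r.
Qed.

Lemma fact_le_expn (n : nat) : (n`! <= n ^ n)%N.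
Proof.
elim: n => // n IHn; rewrite factS expnS leq_mul2l /=.
by case: n IHn => [|n] IHn //; apply: leq_trans IHn _; rewrite leq_exp2r.
Qed.

(** A symmetric matrix of order r + 1 with ones on the diagonal, all of whose other
    entries have an absolute value close to 1 / sqrt (r + 2), is invertible.
    Otherwise let v be a kernel vector and S the matrix of the signs of the
    off-diagonal entries; then v is almost killed by S^2 - (r + 2) I, whereas the
    determinant of the latter is a nonzero integer and its cofactors are at most
    r! r^r in absolute value. *)
Lemma near_equiangular_det_neq0 (R : rcfType) (r : nat) (s eta : R)
    (G : 'M[R]_r.+1) :
  (4 <= r)%N -> ~~ odd r -> (forall k : nat, (r + 2)%N <> (k ^ 2)%N) ->
  0 < s -> s ^+ 2 = r%:R + 2 ->
  0 < eta -> 2 * r%:R ^+ (2 * r + 4) * eta <= 1 ->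
  G^T = G -> (forall i, G i i = 1) ->
  (forall i j, i != j -> `| `|G i j| - s^-1 | <= eta) ->
  \det G != 0.
Proof.
move=> r4 r_even r_nsq s0 s2 eta0 eta_le Gsym G1 Gij.
have rR : 4 <= r%:R :> R by rewrite (ler_nat _ 4).
pose S : 'M[int]_r.+1 := \matrix_(i, j)
  (if i == j then 0 else if G i j < 0 then -1 else 1).
pose A : 'M[R]_r.+1 := map_mx intr S.
(* E is the error made on s G when it is replaced by s I + A. *)
pose E := s *: G - s%:M - A.
pose K := A *m A - (r%:R + 2)%:M.
have S_off i j : i != j -> S i j = 1 \/ S i j = -1.
  by move=> ij; rewrite mxE (negPf ij); case: ifP; [right|left].
have S_diag i : S i i = 0 by rewrite mxE eqxx.
have A_diag i : A i i = 0 by rewrite mxE S_diag.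
have A_off i j : i != j -> `|A i j| = 1.
  by move=> ij; rewrite mxE; case: (S_off _ _ ij) => ->; rewrite ?normrN1 ?normr1.
have A_le1 i j : `|A i j| <= 1.
  by have [<-|/A_off->//] := eqVneq i j; rewrite A_diag normr0.
have A_sym i j : A j i = A i j.
  by rewrite !mxE eq_sym -{1}Gsym mxE.
have sum_off (i : 'I_r.+1) (f : 'I_r.+1 -> R) (b : R) : f i = 0 ->
    (forall j, i != j -> f j <= b) -> \sum_j f j <= b * r%:R.
  move=> fi fj; rewrite (bigD1 i) //= fi add0r.
  apply: le_trans (_ : \sum_(j | j != i) b <= _).
    by apply: ler_sum => j ji; rewrite fj // eq_sym.
  by rewrite sumr_const cardC1 card_ord mulr_natr.
have K_le i j : `|K i j| <= r%:R.
  rewrite !mxE; have [<-|ij] := eqVneq i j.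
    rewrite mulr1n (eq_bigr (fun k => (k != i)%:R)) => [|k _]; last first.
      have [->|ki] := eqVneq k i; first by rewrite A_diag mulr0.
      by rewrite A_sym -expr2 -real_normK ?num_real // A_off ?expr1n.
    rewrite -natr_sum -big_mkcond sum1_card cardC1 card_ord /=.
    by rewrite opprD addNKr normrN normr_nat; lra.
  rewrite mulr0n subr0; apply: le_trans (ler_norm_sum _ _ _) _.
  rewrite -[leRHS]mul1r; apply: (sum_off i); first by rewrite A_diag mul0r normr0.
  by move=> k _; rewrite normrM mulr_ile1.
have E_le j : \sum_i `|E i j| <= s * eta * r%:R.
  apply: (sum_off j); first by rewrite !mxE !eqxx G1 mulr1 mulr1n subrr mulr0z subr0 normr0.
  move=> i ji; have ij : i != j by rewrite eq_sym.
  rewrite !mxE (negPf ij) mulr0n subr0.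
  have -> : `|s * G i j - (if G i j < 0 then -1 else 1)%:~R| =
      s * `| `|G i j| - s^-1|.
    rewrite -{2}(gtr0_norm s0) -normrM mulrBr mulfV ?gt_eqF //.
    case: ltP => G0; last by rewrite (ger0_norm G0).
    by rewrite (ltr0_norm G0) rmorphN1 -[LHS]normrN; congr `|_|; ring.
  by rewrite ler_pM2l ?Gij.
apply/negP => /det0P[v v0 vG].
(* The argument is run at a coordinate k0 of v of largest absolute value x. *)
have [k0 vk0] : exists k0, forall i, `|v 0 i| <= `|v 0 k0|.
  have [] := Order.TotalTheory.arg_maxP (fun i => `|v 0 i|)
    (erefl : xpredT (ord0 : 'I_r.+1)) => k _ kmax.
  by exists k => i; apply: kmax.
set x := `|v 0 k0| in vk0.
have x_gt0 : 0 < x.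
  rewrite lt_neqAle normr_ge0 andbT eq_sym; apply: contra v0 => /eqP x0.
  apply/eqP/rowP => i; rewrite mxE; apply/eqP; rewrite -normr_le0.
  by rewrite -x0 vk0.
have vK : v *m K = - (v *m E) *m (A - s%:M).
  have -> : - (v *m E) = v *m (s%:M + A).
    rewrite /E !mulmxBr -scalemxAr vG scaler0 sub0r opprB opprK mulmxDr.
    by rewrite addrC.
  rewrite -mulmxA; congr (_ *m _).
  rewrite mulmxBr !mulmxDl -!scalar_mxM mul_scalar_mx mul_mx_scalar -expr2 s2 /K.
  by rewrite [s *: A + _]addrC opprD addrACA subrr addr0.
have vE_le j : `|(- (v *m E)) 0 j| <= x * (s * eta * r%:R).
  by rewrite mxE normrN; apply: norm_mulmx_row_le => //; apply: ltW.
have As_le j : \sum_i `|(A - s%:M) i j| <= r%:R + s.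
  rewrite (bigD1 j) //= addrC lerD //.
    apply: le_trans (_ : \sum_(i | i != j) 1 <= _); last first.
      by rewrite sumr_const cardC1 card_ord.
    apply: ler_sum => i ij.
    by rewrite mxE [X in _ + X]mxE [X in - X]mxE (negPf ij) mulr0n subr0 A_le1.
  by rewrite !mxE !eqxx mulr1n mulr0z sub0r normrN gtr0_norm.
have vK_le j : `|(v *m K) 0 j| <= x * (s * eta * r%:R) * (r%:R + s).
  rewrite vK; apply: norm_mulmx_row_le => //.
  by rewrite !mulr_ge0 ?ler0n // ltW.
have adj_le j : \sum_i `|(\adj K) i j| <= (r.+1%:R * (r`!%:R * r%:R ^+ r)).
  apply: le_trans (_ : \sum_(i < r.+1) (r`!%:R * r%:R ^+ r) <= _); last first.
    by rewrite sumr_const card_ord [leRHS]mulr_natl.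
  apply: ler_sum => i _; rewrite mxE /cofactor normrM normrX normrN1 expr1n mul1r.
  apply: norm_det_le_fact => i1 j1; rewrite [X in `|X|]mxE [X in `|X|]mxE.
  exact: K_le.
have := norm_mulmx_row_le vK_le adj_le.
have -> : v *m K *m \adj K = \det K *: v.
  by rewrite -mulmxA mul_mx_adj mul_mx_scalar.
move=> /(_ _ k0); rewrite mxE normrM -/x => H.
have {H} : `|\det K| * x <= x * (s * eta * r%:R) * (r%:R + s) *
    (r.+1%:R * (r`!%:R * r%:R ^+ r)).
  by apply: H; rewrite !mulr_ge0 ?addr_ge0 ?ler0n // ltW.
have : 1 <= `|\det K|.
  have := sign_char_poly_norm (R := R) (s := s) r_even _ r_nsq S_off S_diag.
  by rewrite natrD oddD (negPf r_even); apply.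
have : (r`!%:R * r%:R ^+ r <= r%:R ^+ (2 * r) :> R).
  by rewrite mul2n -addnn exprD ler_wpM2r ?exprn_ge0 // -natrX ler_nat fact_le_expn.
set F := _ * r%:R ^+ r => F_le detK.
(* It remains to see that s (r + s) (r + 1) r <= 25/18 r^4 < 2 r^4, which
   contradicts the bound on eta. *)
rewrite exprD in eta_le.
set u := r%:R ^+ (2 * r) in F_le eta_le.
set y := r%:R in rR s2 eta_le F_le *.
have y0 : 0 < y by apply: lt_le_trans rR.
have u0 : 0 < u by rewrite exprn_gt0.
have F0 : 0 <= F by rewrite mulr_ge0 ?exprn_ge0 ?ler0n.
have s_le : s <= 2 / 3 * y.
  rewrite -(@ler_pXn2r _ 2) ?nnegrE ?(ltW s0) ?mulr_ge0 ?divr_ge0 ?(ltW y0) // s2.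
  have : y * 4 <= y * y by rewrite ler_pM2l.
  by move: rR; clear; lra.
rewrite (_ : r.+1%:R = y + 1); last by rewrite -addn1 natrD.
move=> H.
have : x <= x * (s * eta * y * (y + s) * ((y + 1) * F)).
  apply: le_trans (_ : `|\det K| * x <= _); first by rewrite ler_peMl // ltW.
  by apply: le_trans H _; rewrite !mulrA.
rewrite -subr_ge0 -[X in _ - X]mulr1 -mulrBr pmulr_rge0 // subr_ge0.
apply/negP; rewrite -ltNge.
have y1 : 0 <= y + 1 by rewrite addr_ge0 ?(ltW y0).
have sy : 0 <= y + s by rewrite addr_ge0 ?(ltW y0) ?(ltW s0).
have P_lt : s * (y + s) * (y + 1) < 2 * y ^+ 3.
  have h1 : s * (y + s) <= (2 / 3 * y) * (5 / 3 * y).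
    by apply: ler_pM; rewrite ?(ltW s0) //; move: s_le; clear; lra.
  have h2 : s * (y + s) * (y + 1) <= (2 / 3 * y) * (5 / 3 * y) * (5 / 4 * y).
    apply: ler_pM; rewrite ?mulr_ge0 ?(ltW s0) //.
    by move: rR; clear; lra.
  apply: le_lt_trans h2 _.
  rewrite -subr_gt0 (_ : _ - _ = (11 / 18) * y ^+ 3); last by field.
  by rewrite mulr_gt0 ?exprn_gt0 ?divr_gt0.
apply: lt_le_trans eta_le.
apply: (@le_lt_trans _ _ (s * (y + s) * (y + 1) * (y * eta * u))).
  rewrite (_ : _ * (_ * F) = s * (y + s) * (y + 1) * (y * eta * F)); last by ring.
  by rewrite !ler_wpM2l ?mulr_ge0 ?(ltW s0) ?(ltW eta0) ?(ltW y0).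
rewrite (_ : 2 * _ * eta = 2 * y ^+ 3 * (y * eta * u)); last by ring.
by rewrite ltr_pM2r ?mulr_gt0.
Qed.

(** * Moments of an orthogonal projection *)

Lemma mxtrace_idempotent (F : fieldType) (n : nat) (Q : 'M[F]_n) :
  Q *m Q = Q -> \tr Q = (\rank Q)%:R.
Proof.
move=> QQ.
have /row_freeP[B RB] := row_base_free Q.
have /row_fullP[D DC] := col_base_full Q.
move: (mulmx_base Q) RB DC; move: (col_base Q) (row_base Q) => C P CP PB DC.
rewrite -[in LHS]CP mxtrace_mulC -mxtrace1; congr (\tr _).
have : D *m (C *m P *m (C *m P)) *m B = D *m (C *m P) *m B by rewrite CP QQ.
by rewrite -!mulmxA PB !mulmx1 !mulmxA DC mul1mx.
Qed.

Lemma det_mxsub_gt_rank (F : fieldType) (n r : nat) (Q : 'M[F]_n)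
    (f : 'I_r -> 'I_n) : (\rank Q < r)%N -> \det (mxsub f f Q) = 0.
Proof.
move=> Qr; apply/eqP; apply: contraTT Qr => det0.
have rk_le : (\rank (mxsub f f Q) <= \rank Q)%N.
  rewrite -{1}(mulmx_base Q) mxsub_mul.
  exact: leq_trans (mxrankM_maxr _ _) (rank_leq_row _).
by rewrite -leqNgt; apply: leq_trans rk_le; rewrite mxrank_unit // unitmxE unitfE.
Qed.

Section FourFoldSums.
Variables (R : comPzRingType) (n : nat).

(** Summation of an array with four indices. *)
Definition sum4 (F : 'I_n -> 'I_n -> 'I_n -> 'I_n -> R) : R :=
  \sum_a \sum_b \sum_c \sum_d F a b c d.

Lemma eq_sum4 F G : (forall a b c d, F a b c d = G a b c d) -> sum4 F = sum4 G.
Proof. by move=> FG; do 4 (apply: eq_bigr => ? _). Qed.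

Lemma sum4D F G :
  sum4 (fun a b c d => F a b c d + G a b c d) = sum4 F + sum4 G.
Proof.
by rewrite /sum4 -!big_split; do 3 (apply: eq_bigr => ? _; rewrite -?big_split).
Qed.

Lemma sum4Z x F : sum4 (fun a b c d => x * F a b c d) = x * sum4 F.
Proof. by rewrite /sum4; do 4 (rewrite mulr_sumr; apply: eq_bigr => ? _). Qed.

Lemma sum4_sum (I : finType) (F : I -> 'I_n -> 'I_n -> 'I_n -> 'I_n -> R) :
  sum4 (fun a b c d => \sum_i F i a b c d) = \sum_i sum4 (F i).
Proof.
by rewrite /sum4; do 4 (rewrite [RHS]exchange_big; apply: eq_bigr => ? _).
Qed.

Lemma sum4_swap_bc F : sum4 F = sum4 (fun a b c d => F a c b d).
Proof. by apply: eq_bigr => a _; rewrite exchange_big. Qed.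

Lemma sum4_swap_cd F : sum4 F = sum4 (fun a b c d => F a b d c).
Proof. by do 2 (apply: eq_bigr => ? _); rewrite exchange_big. Qed.

End FourFoldSums.

Section Projection.
Variables (R : rcfType) (n : nat) (Q : 'M[R]_n).
Hypotheses (QT : Q^T = Q) (QQ : Q *m Q = Q).

Lemma proj_sym i j : Q i j = Q j i.
Proof. by rewrite -{1}QT mxE. Qed.

Lemma proj_contract x i j : \sum_k x * (Q i k * Q j k) = x * Q i j.
Proof.
rewrite -mulr_sumr; congr (_ * _); rewrite -[in RHS]QQ mxE.
by apply: eq_bigr => k _; rewrite [Q j k]proj_sym.
Qed.

Lemma proj_sumE x i j (F : 'I_n -> R) y :
  (forall k, F k = x * (Q i k * Q j k)) -> x * Q i j = y -> \sum_k F k = y.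
Proof. by move=> FE <-; rewrite -proj_contract; apply: eq_bigr => k _. Qed.

Lemma proj_diag_sum_sqr i : Q i i = \sum_k Q i k ^+ 2.
Proof.
rewrite -[LHS]mul1r -proj_contract; apply: eq_bigr => k _.
by rewrite mul1r expr2.
Qed.

(* The symmetrization of Q (x) Q over the three pairings of four indices. *)
Let pairing a b c d := Q a b * Q c d + Q a c * Q b d + Q a d * Q b c.

(** The three pairings have the same scalar product with a symmetric array. *)
Lemma sum4_pairing (G : 'I_n -> 'I_n -> 'I_n -> 'I_n -> R) :
  (forall a b c d, G a b c d = G a c b d) ->
  (forall a b c d, G a b c d = G a b d c) ->
  sum4 (fun a b c d => pairing a b c d * G a b c d) =
  3 * sum4 (fun a b c d => Q a b * Q c d * G a b c d).
Proof.
move=> Gbc Gcd.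
have E2 : sum4 (fun a b c d => Q a c * Q b d * G a b c d) =
          sum4 (fun a b c d => Q a b * Q c d * G a b c d).
  by rewrite sum4_swap_bc; apply: eq_sum4 => a b c d; rewrite -Gbc.
have E3 : sum4 (fun a b c d => Q a d * Q b c * G a b c d) =
          sum4 (fun a b c d => Q a c * Q b d * G a b c d).
  by rewrite sum4_swap_cd; apply: eq_sum4 => a b c d; rewrite -Gcd.
rewrite (@eq_sum4 _ _ _ (fun a b c d => Q a b * Q c d * G a b c d +
  Q a c * Q b d * G a b c d + Q a d * Q b c * G a b c d)); last first.
  by move=> a b c d; rewrite /pairing !mulrDl.
by rewrite !sum4D E3 E2; ring.
Qed.

Lemma sum4_rank1_rank1 i j :
  sum4 (fun a b c d => (Q i a * Q i b * Q i c * Q i d) *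
                       (Q j a * Q j b * Q j c * Q j d)) = Q i j ^+ 4.
Proof.
apply: (@proj_sumE (Q i j ^+ 3) i j) => [a|]; last by ring.
apply: (@proj_sumE (Q i a * Q j a * Q i j ^+ 2) i j) => [b|]; last by ring.
apply: (@proj_sumE (Q i a * Q i b * Q j a * Q j b * Q i j) i j) => [c|]; last by ring.
apply: (@proj_sumE (Q i a * Q i b * Q i c * Q j a * Q j b * Q j c) i j) => [d|]; ring.
Qed.

Lemma sum4_pair_rank1 i :
  sum4 (fun a b c d => Q a b * Q c d * (Q i a * Q i b * Q i c * Q i d)) =
  Q i i ^+ 2.
Proof.
apply: (@proj_sumE (Q i i) i i) => [a|]; last by ring.
apply: (@proj_sumE (Q i a * Q i i) i a) => [b|]; last by ring.
apply: (@proj_sumE (Q i a * Q i b * Q a b) i i) => [c|]; last by ring.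
apply: (@proj_sumE (Q i a * Q i b * Q a b * Q i c) i c) => [d|]; ring.
Qed.

Lemma sum4_pair_pairing :
  sum4 (fun a b c d => Q a b * Q c d * pairing a b c d) =
  (\tr Q) ^+ 2 + 2 * \tr Q.
Proof.
have sumQ : \sum_a \sum_b Q a b * Q a b = \tr Q.
  apply: eq_bigr => a _; rewrite -[RHS]mul1r -proj_contract.
  by apply: eq_bigr => b _; rewrite mul1r.
transitivity (sum4 (fun a b c d => (Q a b * Q a b) * (Q c d * Q c d)) +
  sum4 (fun a b c d => (Q a b * Q a c) * (Q c d * Q b d)) +
  sum4 (fun a b c d => (Q a b * Q b c) * (Q a d * Q c d))).
  by rewrite -!sum4D; apply: eq_sum4 => a b c d; rewrite /pairing; ring.
rewrite (_ : sum4 _ = (\tr Q) ^+ 2); last first.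
  rewrite expr2 -{1}sumQ mulr_suml; apply: eq_bigr => a _.
  rewrite mulr_suml; apply: eq_bigr => b _.
  rewrite -sumQ mulr_sumr; apply: eq_bigr => c _.
  by rewrite mulr_sumr.
rewrite -addrA; congr (_ + _); rewrite mulr2n mulrDl mul1r; congr (_ + _).
  rewrite -sumQ; apply: eq_bigr => a _; apply: eq_bigr => b _.
  apply: (@proj_sumE (Q a b) a b) => // c.
  by rewrite proj_contract [Q c b]proj_sym; ring.
rewrite -sumQ; apply: eq_bigr => a _; apply: eq_bigr => b _.
apply: (@proj_sumE (Q a b) a b) => // c.
by rewrite proj_contract; ring.
Qed.

(** Lower bound on the fourth moment of a tight frame.  With u_i the rows of Q, the
    symmetric tensor sum_i w_i u_i^(x)4 is compared with the multiple of the
    pairing tensor that the fourth moment of the sphere would give; the squared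
    norm of the difference is nonnegative. *)
Lemma proj_fourth_moment (w : 'I_n -> R) : 0 < \tr Q ->
  3 * (\sum_i w i * Q i i ^+ 2) ^+ 2 <=
  \tr Q * (\tr Q + 2) * \sum_i \sum_j w i * w j * Q i j ^+ 4.
Proof.
set r := \tr Q; set A := \sum_i w i * _; set M := \sum_i _ => r0.
pose T a b c d := \sum_i w i * (Q i a * Q i b * Q i c * Q i d).
have TG G : sum4 (fun a b c d => T a b c d * G a b c d) =
    \sum_i w i * sum4 (fun a b c d => Q i a * Q i b * Q i c * Q i d * G a b c d).
  rewrite -(eq_bigr _ (fun i _ => sum4Z _ _)) -sum4_sum.
  by apply: eq_sum4 => a b c d; rewrite mulr_suml; apply: eq_bigr => i _; rewrite !mulrA.
have TT : sum4 (fun a b c d => T a b c d * T a b c d) = M.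
  rewrite TG; apply: eq_bigr => i _.
  rewrite (@eq_sum4 _ _ _ (fun a b c d => T a b c d * (Q i a * Q i b * Q i c * Q i d))); last first.
    by move=> *; rewrite mulrC.
  rewrite TG mulr_sumr; apply: eq_bigr => j _.
  by rewrite sum4_rank1_rank1 [Q j i]proj_sym mulrA.
have TX : sum4 (fun a b c d => T a b c d * pairing a b c d) = 3 * A.
  rewrite TG mulr_sumr; apply: eq_bigr => i _.
  rewrite mulrCA; congr (_ * _); rewrite -sum4_pair_rank1 -sum4_pairing.
  - by apply: eq_sum4 => *; rewrite mulrC.
  - by move=> *; ring.
  - by move=> *; ring.
have XX : sum4 (fun a b c d => pairing a b c d * pairing a b c d) = 3 * (r * (r + 2)).
  rewrite sum4_pairing.
  - by rewrite sum4_pair_pairing -/r; ring.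
  - by move=> a b c d; rewrite /pairing [Q c b]proj_sym; ring.
  - by move=> a b c d; rewrite /pairing [Q d c]proj_sym; ring.
set k := r * (r + 2).
have k0 : 0 < k by rewrite /k mulr_gt0 //; lra.
have : 0 <= sum4 (fun a b c d => (k * T a b c d - A * pairing a b c d) ^+ 2).
  by do 4 (apply: sumr_ge0 => ? _); exact: sqr_ge0.
rewrite (@eq_sum4 _ _ _ (fun a b c d => k ^+ 2 * (T a b c d * T a b c d) +
   (- (2 * k * A) * (T a b c d * pairing a b c d) +
   A ^+ 2 * (pairing a b c d * pairing a b c d)))); last by move=> *; ring.
rewrite !sum4D !sum4Z TT TX XX -/k.
rewrite (_ : _ + _ = k * (k * M - 3 * A ^+ 2)); last by ring.
by rewrite pmulr_rge0 // subr_ge0.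
Qed.

(** Upper bound on the second moment.  With D = diag d and Z = Q D Q the sum is
    both the squared Frobenius norm of Z and its scalar product with D Q, so that
    it is at most the squared Frobenius norm of D Q, which is the sum of the
    d_i^2 Q_ii. *)
Lemma proj_second_moment (d : 'I_n -> R) :
  (forall i, d i ^+ 2 * Q i i <= 1) ->
  \sum_i \sum_j d i * d j * Q i j ^+ 2 <= n%:R.
Proof.
move=> dQ.
pose Z i j := \sum_k d k * (Q i k * Q j k).
set F := \sum_i _.
have ZZ : \sum_i \sum_j Z i j ^+ 2 = F.
  transitivity (sum4 (fun i j k l =>
      d k * (Q i k * Q j k) * (d l * (Q i l * Q j l)))).
    do 2 (apply: eq_bigr => ? _); rewrite expr2 mulr_suml.
    by apply: eq_bigr => k _; rewrite mulr_sumr.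
  rewrite sum4_swap_bc /sum4 exchange_big; apply: eq_bigr => k _ /=.
  rewrite (eq_bigr _ (fun i _ => exchange_big _ _ _ _ _ _)) exchange_big.
  apply: eq_bigr => l _ /=.
  apply: (@proj_sumE (d k * d l * Q k l) k l) => [i|]; last by ring.
  rewrite [Q k i]proj_sym [Q l i]proj_sym.
  apply: (@proj_sumE (d k * d l * Q i k * Q i l) k l) => [j|]; last by ring.
  by rewrite [Q k j]proj_sym [Q l j]proj_sym; ring.
have ZQ i : \sum_j Z i j * Q i j = Z i i.
  rewrite (eq_bigr (fun j => \sum_k d k * (Q i k * Q j k) * Q i j)); last first.
    by move=> j _; rewrite mulr_suml.
  rewrite exchange_big; apply: eq_bigr => k _.
  apply: (@proj_sumE (d k * Q i k) i k) => [j|]; last by ring.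
  by rewrite [Q k j]proj_sym; ring.
have FE : F = \sum_i \sum_j Z i j * (d i * Q i j).
  apply: eq_bigr => i _; transitivity (d i * Z i i).
    by rewrite mulr_sumr; apply: eq_bigr => j _; ring.
  by rewrite -ZQ mulr_sumr; apply: eq_bigr => j _; ring.
(* 2 Z_ij (d_i Q_ij) <= Z_ij^2 + (d_i Q_ij)^2, summed over i and j. *)
have : F *+ 2 <= F + n%:R; last by rewrite mulr2n lerD2l.
have -> : n%:R = \sum_(i < n) 1 :> R by rewrite sumr_const card_ord.
rewrite -{2}ZZ {1}FE -sumrMnl -big_split.
apply: ler_sum => i _ /=.
apply: (@le_trans _ _ (\sum_j Z i j ^+ 2 + d i ^+ 2 * Q i i)); last first.
  by rewrite lerD2l dQ.
rewrite proj_diag_sum_sqr mulr_sumr -sumrMnl -big_split; apply: ler_sum => j _ /=.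
by rewrite -subr_ge0 (_ : _ - _ = (Z i j - d i * Q i j) ^+ 2) ?sqr_ge0 //; ring.
Qed.

Lemma proj_diag_eq0 i j : Q i i = 0 -> Q i j = 0.
Proof.
rewrite proj_diag_sum_sqr => /psumr_eq0P E; apply/eqP.
by rewrite -sqrf_eq0 E // => k _; exact: sqr_ge0.
Qed.

Lemma proj_normalized_le1 (x y : R) i j :
  x ^+ 2 * Q i i <= 1 -> y ^+ 2 * Q j j <= 1 -> `|x * y * Q i j| <= 1.
Proof.
move=> xi yj.
have expand (z : R) :
    0 <= x ^+ 2 * Q i i + (2 * x * z) * Q i j + z ^+ 2 * Q j j.
  rewrite -!proj_contract -!big_split sumr_ge0 // => k _ /=.
  by rewrite (_ : _ + _ = (x * Q i k + z * Q j k) ^+ 2) ?sqr_ge0 //; ring.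
rewrite ler_norml; have := expand y; have := expand (- y).
by rewrite sqrrN; lra.
Qed.
End Projection.

(** * Near equality in the quartic bound *)

(** The gap, up to the factor 2 c (1 + c)^2, between |t| and the even quartic
    polynomial in t which agrees with |t| at |t| = 1 and touches it at
    |t| = c. *)
Definition defect (R : numDomainType) (c t : R) : R :=
  (`|t| - c) ^+ 2 * ((1 - `|t|) * (1 + `|t| + 2 * c)).

Lemma defectE (R : realDomainType) (c t : R) :
  2 * c * (1 + c) ^+ 2 * `|t| =
  - t ^+ 4 + (1 + 2 * c + 3 * c ^+ 2) * t ^+ 2 + c ^+ 2 * (1 + 2 * c)
  - defect c t.
Proof.
rewrite /defect -[t ^+ 4]/(t ^+ (2 * 2)) exprM -[t ^+ 2]real_normK ?num_real //.
by ring.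
Qed.

Lemma defect_ge0 (R : realDomainType) (c t : R) :
  0 <= c -> `|t| <= 1 -> 0 <= defect c t.
Proof.
move=> c0 t1; rewrite mulr_ge0 ?sqr_ge0 // mulr_ge0 ?subr_ge0 //.
by have := normr_ge0 t; lra.
Qed.

(** The indicator of the condition that |t| is farther than eta from c is bounded
    by the second moment and the defect.  Where it holds, either t^2 is close to 1
    and the first term is at least 1, or the defect is at least 5/18 eta^2. *)
Lemma off_angle_le (R : realFieldType) (c eta t : R) :
  0 < c -> 6 * c ^+ 2 <= 1 -> 0 < eta -> `|t| <= 1 ->
  (eta < `| `|t| - c |)%R%:R <=
  3 / (2 * (1 - c ^+ 2)) * (t ^+ 2 - c ^+ 2 + 2 * c * eta)
  + 5 / eta ^+ 2 * defect c t.
Proof.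
move=> c0 c6 eta0 t1.
have H0 := defect_ge0 (ltW c0) t1.
have := normr_ge0 t; rewrite -[t ^+ 2]real_normK ?num_real //.
move: H0; rewrite /defect; move: t1; set u := `|t| => u1 H0 u0.
have c20 : 0 <= c ^+ 2 by exact: sqr_ge0.
set al := 3 / _.
have al0 : 0 < al by rewrite divr_gt0 //; lra.
have alE : al * (1 - c ^+ 2) = 3 / 2 by rewrite /al; field; apply/eqP; lra.
have e20 : 0 < eta ^+ 2 by rewrite exprn_gt0.
have L0 : 0 < 5 / eta ^+ 2 by rewrite divr_gt0.
have Hterm := mulr_ge0 (ltW L0) H0.
have ce0 : 0 <= c * eta by rewrite mulr_ge0 ?ltW.
have [off|near] /= := ltP; last first.
  apply: addr_ge0 => //; apply: mulr_ge0; first exact: ltW.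
  have cu_le : c - u <= eta.
    by apply: le_trans near; rewrite -normrN opprB ler_norm.
  have [uc|cu] := leP u c; last first.
    have : 0 <= (u - c) * (u + c).
      by rewrite mulr_ge0 ?subr_ge0 ?addr_ge0 ?(ltW cu) ?(ltW c0).
    by move: ce0; clear; lra.
  have : (c - u) * (c + u) <= eta * (2 * c).
    by apply: ler_pM; rewrite ?subr_ge0 ?addr_ge0 ?(ltW c0) //; move: uc; clear; lra.
  by clear; lra.
rewrite mulrDr.
have al_ce : 0 <= al * (2 * c * eta) by rewrite mulr_ge0 ?(ltW al0) // -mulrA mulr_ge0.
(* Either t^2 is close to 1, or |t| is far both from c and from 1. *)
have [close|mid] := leP (2 / 3 * (1 - c ^+ 2)) (u ^+ 2 - c ^+ 2).
  have : al * (2 / 3 * (1 - c ^+ 2)) <= al * (u ^+ 2 - c ^+ 2) by rewrite ler_pM2l.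
  by move: Hterm al_ce alE; clear; lra.
have low : - (3 / 10) <= al * (u ^+ 2 - c ^+ 2).
  have : 0 <= al * u ^+ 2 by rewrite mulr_ge0 ?sqr_ge0 ?(ltW al0).
  have : al * (6 * c ^+ 2) <= al * 1 by rewrite ler_pM2l.
  by move: alE; clear; lra.
have sq : eta ^+ 2 <= (u - c) ^+ 2.
  by rewrite -[leRHS]real_normK ?num_real // ler_pXn2r ?nnegrE ?normr_ge0 ?ltW.
have gap : 5 / 18 <= (1 - u) * (1 + u + 2 * c).
  have : 0 <= (1 - u) * c by rewrite mulr_ge0 ?subr_ge0 ?(ltW c0).
  by move: mid c6; clear; lra.
have : 5 / eta ^+ 2 * (eta ^+ 2 * (5 / 18)) <=
       5 / eta ^+ 2 * ((u - c) ^+ 2 * ((1 - u) * (1 + u + 2 * c))).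
  by rewrite ler_pM2l //; apply: ler_pM; rewrite ?(ltW e20) ?divr_ge0.
rewrite [leLHS](_ : _ = 25 / 18); last by field; rewrite gt_eqF.
by move: low al_ce; clear; lra.
Qed.

Lemma angle_le_half (R : realFieldType) (y c : R) :
  4 <= y -> 0 < c -> c ^+ 2 * (y + 2) = 1 -> c <= 1 / 2.
Proof.
move=> y4 c0 cy; rewrite leNgt; apply/negP => c_gt.
have : 0 < (c - 1 / 2) * (c + 1 / 2) by rewrite mulr_gt0 //; lra.
have : c ^+ 2 * 4 <= c ^+ 2 * (y + 2) by rewrite ler_wpM2l ?sqr_ge0 //; lra.
by move: cy; clear; lra.
Qed.

(** In the next two lemmas y is the rank, c = 1 / sqrt (y + 2), A2 the square of the
    total weight, M2 and M4 the second and fourth moments, MH the total defect and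
    L the norm to be bounded.  Substituting the bounds on M2, M4 and A2 in the
    expression of L gives (y + 1/c) / (1 + 1/c) times n; if L is within eps n of
    this value, then every inequality used is nearly an equality. *)
Lemma near_extremal_estimates (R : realFieldType)
    (y c eps n A2 M2 M4 MH L : R) :
  4 <= y -> 0 < c -> c ^+ 2 * (y + 2) = 1 ->
  800 * ((y + 2) * eps) <= y -> 0 < eps -> 0 < n -> 0 <= A2 ->
  M2 <= n -> 3 * A2 <= y * (y + 2) * M4 -> A2 <= n * y -> 0 <= MH ->
  2 * c * (1 + c) ^+ 2 * L =
    - M4 + (1 + 2 * c + 3 * c ^+ 2) * M2 + c ^+ 2 * (1 + 2 * c) * A2 - MH ->
  ((y + c^-1) / (1 + c^-1) - eps) * n < L ->
  MH < 3 * eps * n /\ 98 / 100 * (y * n) <= A2.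
Proof.
move=> y4 c0 cy eps_le eps0 n0 A20 M2n M4A An MH0 LE Lgt.
have cn : c != 0 by rewrite gt_eqF.
have c2_gt0 : 0 < c ^+ 2 by rewrite exprn_gt0.
have yE : y = c^-1 ^+ 2 - 2.
  apply: (mulfI (expf_neq0 2 cn)); rewrite mulrBr -exprMn mulfV // expr1n -[X in X - _]cy.
  by ring.
have c_le := angle_le_half y4 c0 cy.
have y0 : 0 < y by apply: lt_le_trans y4.
have yn : y != 0 by rewrite gt_eqF.
pose K0 := c ^+ 2 * (1 + 2 * c) - 3 * c ^+ 2 / y.
have K0_ge : c ^+ 2 / 4 <= K0.
  rewrite /K0 (_ : _ - _ = c ^+ 2 * (1 + 2 * c - 3 / y)); last by ring.
  rewrite ler_pM2l //.
  have : 3 / y <= 3 / 4 by rewrite ler_pM2l // lef_pV2 ?posrE.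
  by move: c0; clear; lra.
set D := 2 * c * (1 + c) ^+ 2 in LE.
have D0 : 0 < D.
  by rewrite mulr_gt0 ?exprn_gt0 ?mulr_gt0 //; apply: addr_gt0.
have D2 : D <= 9 / 4.
  rewrite /D (_ : 9 / 4 = (2 * (1 / 2)) * (1 + 1 / 2) ^+ 2); last by field.
  apply: ler_pM; rewrite ?sqr_ge0 ?mulr_ge0 ?(ltW c0) // ?ler_pM2l //.
  by rewrite ler_pXn2r ?nnegrE ?lerD2l ?addr_ge0 ?divr_ge0 ?(ltW c0).
have DB : D * ((y + c^-1) / (1 + c^-1)) = (1 + 2 * c + 3 * c ^+ 2) + K0 * y.
  by rewrite /K0 mulrBl divfK // /D yE; field; rewrite cn gt_eqF // addr_gt0.
(* The nonnegative deficits in the bounds on A2 and on the defect add up to less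
   than the total gap. *)
have main : K0 * (y * n - A2) + MH < 3 * eps * n.
  have M4_ge : 3 * c ^+ 2 / y * A2 <= M4.
    rewrite -(@ler_pM2l _ (y * (y + 2))); last by rewrite mulr_gt0 //; lra.
    apply: le_trans M4A.
    rewrite [leLHS](_ : _ = 3 * A2 * (c ^+ 2 * (y + 2))); last by field.
    by rewrite cy mulr1.
  have M2_le : (1 + 2 * c + 3 * c ^+ 2) * M2 <= (1 + 2 * c + 3 * c ^+ 2) * n.
    by rewrite ler_wpM2l // !addr_ge0 ?mulr_ge0 ?(ltW c0) ?(ltW c2_gt0).
  have Deps : D * eps * n <= 3 * eps * n.
    by rewrite !ler_wpM2r ?(ltW eps0) ?(ltW n0) //; lra.
  have : D * (((y + c^-1) / (1 + c^-1) - eps) * n) < D * L by rewrite ltr_pM2l.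
  rewrite (_ : D * (_ * n) = (D * ((y + c^-1) / (1 + c^-1))) * n - D * eps * n);
    last by ring.
  rewrite DB LE; move: M4_ge M2_le Deps; rewrite /K0; clear; lra.
have yA : 0 <= y * n - A2 by rewrite subr_ge0 mulrC.
have K0_ge0 : 0 <= K0 by apply: le_trans K0_ge; rewrite divr_ge0 ?sqr_ge0.
have K0A := mulr_ge0 K0_ge0 yA.
split; first by move: main K0A; clear; lra.
have E1 : (y + 2) * (c ^+ 2 / 4 * (y * n - A2)) <= (y + 2) * (3 * eps * n).
  rewrite ler_wpM2l //; first by lra.
  apply: le_trans (ler_wpM2r yA K0_ge) _.
  by move: main MH0; clear; lra.
have E2 : (y + 2) * (c ^+ 2 / 4 * (y * n - A2)) = (y * n - A2) / 4.
  rewrite [LHS](_ : _ = c ^+ 2 * (y + 2) * (y * n - A2) / 4); last by field.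
  by rewrite cy mul1r.
have E3 : 800 * ((y + 2) * eps) * n <= y * n by rewrite ler_pM2r.
by move: E1 E2 E3 A20; clear; lra.
Qed.

(** In the extremal case the pairs at a wrong angle make up 2 / (y (y + 1)) of the
    total weight.  The estimate of their weight B by the second moment and the
    defect loses little more than a factor 3/2, and stays below 1 / y. *)
Lemma off_angle_weight_lt (R : realFieldType) (y c eps eta n A2 M2 MH B : R) :
  4 <= y -> 0 < c -> c ^+ 2 * (y + 2) = 1 -> 0 < eta ->
  20 * (eta * y) <= 1 -> 200 * eps <= eta ^+ 2 -> 0 < n ->
  M2 <= n -> MH <= 3 * eps * n -> 98 / 100 * (y * n) <= A2 ->
  B <= 3 / (2 * (1 - c ^+ 2)) * (M2 - c ^+ 2 * A2 + 2 * c * eta * A2)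
       + 5 / eta ^+ 2 * MH ->
  y * B < A2.
Proof.
move=> y4 c0 cy eta0 eta_le eps_le n0 M2n MH_le yn_le BE.
have y0 : 0 < y by lra.
have yn0 : 0 < y * n by rewrite mulr_gt0.
have A2_gt0 : 0 < A2 by move: yn0 yn_le; clear; lra.
have c2_gt0 : 0 < c ^+ 2 by rewrite exprn_gt0.
have c_le := angle_le_half y4 c0 cy.
set al := 3 / _ in BE.
have y1 : 0 < y + 1 by lra.
have al_y : al * (y + 1) = 3 / 2 * (y + 2).
  have c2 : 1 - c ^+ 2 = c ^+ 2 * (y + 1) by move: cy; clear; lra.
  have cn : c ^+ 2 != 0 by rewrite gt_eqF.
  apply: (mulIf cn); rewrite -[RHS]mulrA [(y + 2) * _]mulrC cy mulr1 /al c2.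
  by field; rewrite !gt_eqF.
have al0 : 0 < al by rewrite /al divr_gt0 // mulr_gt0 //; nra.
have al_le : al <= 9 / 5.
  by rewrite -(@ler_pM2r _ (y + 1)) // al_y; move: y4; clear; lra.
have T1 : y * (al * (M2 - c ^+ 2 * A2)) <= 64 / 100 * A2.
  have S1 : y * (M2 - c ^+ 2 * A2) <= (100 / 98 - y * c ^+ 2) * A2.
    have : y * M2 <= y * n by rewrite ler_pM2l.
    by move: yn_le; clear; lra.
  have S2 : (y + 1) * (y * (al * (M2 - c ^+ 2 * A2))) <=
            3 / 2 * (y + 2) * ((100 / 98 - y * c ^+ 2) * A2).
    rewrite [leLHS](_ : _ = al * (y + 1) * (y * (M2 - c ^+ 2 * A2))); last by ring.
    by rewrite al_y ler_wpM2l //; move: y4; clear; lra.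
  rewrite -(@ler_pM2l _ (y + 1)) //; apply: le_trans S2 _.
  rewrite [leLHS](_ : _ = 3 / 2 * ((y + 2) * (100 / 98) - y * (c ^+ 2 * (y + 2))) * A2);
    last by ring.
  by rewrite cy [leRHS]mulrA ler_pM2r //; move: y4; clear; lra.
have T2 : y * (al * (2 * c * eta * A2)) <= 9 / 100 * A2.
  rewrite [leLHS](_ : _ = al * c * (2 * (eta * y)) * A2); last by ring.
  rewrite ler_pM2r // (_ : 9 / 100 = 9 / 5 * (1 / 2) * (1 / 10)); last by field.
  apply: ler_pM.
  - by rewrite mulr_ge0 ?(ltW al0) ?(ltW c0).
  - by rewrite mulr_ge0 // mulr_ge0 ?(ltW eta0) ?(ltW y0).
  - by apply: ler_pM; rewrite ?(ltW al0) ?(ltW c0).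
  - by move: eta_le; clear; lra.
have T3 : y * (5 / eta ^+ 2 * MH) <= 8 / 100 * A2.
  have e20 : 0 < eta ^+ 2 by rewrite exprn_gt0.
  have S1 : MH <= eta ^+ 2 * (3 / 200) * n.
    have : 200 * eps * n <= eta ^+ 2 * n by rewrite ler_pM2r.
    by move: MH_le; clear; lra.
  have : y * (5 / eta ^+ 2 * MH) <= y * (5 / eta ^+ 2 * (eta ^+ 2 * (3 / 200) * n)).
    by rewrite ler_pM2l // ler_pM2l // divr_gt0.
  rewrite [leRHS](_ : _ = 15 / 200 * (y * n)).
    by move/le_trans; apply; move: yn_le A2_gt0; clear; lra.
  by field; rewrite gt_eqF.
apply: le_lt_trans (ler_wpM2l (ltW y0) BE) _.
rewrite !mulrDr in T1 T2 T3 *.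
by move: T1 T2 T3 A2_gt0; clear; lra.
Qed.

(** The tolerance eta = 1 / (2 r^(2r+4)) on the cosines, and its comparison with the
    gap of the theorem. *)
Lemma gap_constants (R : realFieldType) (r : nat) : (4 <= r)%N ->
  exists eta : R, [/\ 0 < eta, 2 * r%:R ^+ (2 * r + 4) * eta = 1,
    20 * (eta * r%:R) <= 1 &
    200 * (r%:R / (2 * (2 * r%:R) ^+ (4 * r + 8))) <= eta ^+ 2].
Proof.
move=> r4; set y : R := r%:R.
have y4 : 4 <= y by rewrite (ler_nat _ 4).
have y0 : 0 < y by lra.
set u := y ^+ (2 * r + 4); set eps := y / _.
have u0 : 0 < u by rewrite exprn_gt0.
have epsE : eps = y / (2 ^+ (4 * r + 9) * u ^+ 2).
  by rewrite /eps exprMn /u -exprM mulrA -exprS; congr (_ / (_ ^+ _ * _ ^+ _)); lia.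
have u_ge : 10 * y <= u.
  rewrite /u addnS exprSr ler_pM2r //.
  apply: (@le_trans _ _ (y ^+ 2)); last first.
    by rewrite ler_eXn2l //; [lia | lra].
  have : 4 * 4 <= y * y by apply: ler_pM; lra.
  by rewrite expr2; lra.
exists (2 * u)^-1; split.
- by rewrite invr_gt0 mulr_gt0.
- by rewrite mulfV // gt_eqF // mulr_gt0.
- by rewrite mulrCA mulrC ler_pdivrMr ?mulr_gt0 //; lra.
- set p := 2 ^+ (4 * r + 9) in epsE.
  have p0 : 0 < p by rewrite exprn_gt0.
  have p_ge : 800 * y <= p.
    rewrite /p /y -natrM -natrX ler_nat.
    rewrite (_ : (4 * r + 9)%N = (r + (3 * r + 9))%N); last by lia.
    rewrite expnD mulnC leq_mul //; first exact: ltnW (ltn_expl _ _).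
    apply: (@leq_trans (2 ^ 10)) => //; rewrite leq_exp2l //; lia.
  rewrite epsE exprVn exprMn {epsE}; move: p p0 p_ge => p p0 p_ge.
  rewrite [leLHS](_ : _ = 800 * y / p * (2 ^+ 2 * u ^+ 2)^-1); last first.
    by field; rewrite !gt_eqF.
  apply: ler_piMl; last by rewrite ler_pdivrMr // mul1r.
  by apply: ltW; rewrite invr_gt0 !mulr_gt0.
Qed.

Lemma gap_le_rank (R : realFieldType) (y eps eta : R) :
  4 <= y -> 0 < eta -> 20 * (eta * y) <= 1 -> 200 * eps <= eta ^+ 2 ->
  800 * ((y + 2) * eps) <= y.
Proof.
move=> y4 eta0 eta_le eps_le.
have eta4 : eta * 4 <= eta * y by rewrite ler_pM2l.
have eta80 : eta ^+ 2 <= 1 / 80 * eta.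
  by rewrite expr2 ler_pM2r //; move: eta4 eta_le; clear; lra.
have : (y + 2) * (200 * eps) <= (y + 2) * (1 / 80 * eta).
  by rewrite ler_pM2l; [exact: le_trans eps_le eta80 | lra].
by move: eta4 eta_le y4; clear; lra.
Qed.

(** * The gap *)

Section Gap.
Variables (R : realType) (r n : nat) (Q : 'M[R]_n).
Hypotheses (r4 : (4 <= r)%N) (r_even : ~~ odd r).
Hypothesis r_nsq : forall m : nat, (r + 2)%N <> (m ^ 2)%N.
Hypotheses (QT : Q^T = Q) (QQ : Q *m Q = Q) (Qr : \rank Q = r).

(* With Q = U U^T, a i is the length of the i-th row of U and t i j the cosine of
   the angle between the rows i and j.  Since the inverse of 0 is 0, t i j
   vanishes if one of these rows does. *)
Let a i := Num.sqrt (Q i i).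
Let d i := (a i)^-1.
Let t i j := d i * d j * Q i j.

Let Qii_ge0 i : 0 <= Q i i.
Proof. by rewrite proj_diag_sum_sqr // sumr_ge0 // => k _; exact: sqr_ge0. Qed.

Let a_sqr i : a i ^+ 2 = Q i i.
Proof. exact: sqr_sqrtr. Qed.

Let a_ge0 i : 0 <= a i. Proof. exact: sqrtr_ge0. Qed.

Let a0_Q0 i j : a i = 0 -> Q i j = 0.
Proof. by move=> a0; apply: proj_diag_eq0; rewrite // -a_sqr a0 expr0n. Qed.

Let adQ i j : a i * d i * Q i j = Q i j.
Proof.
rewrite /d; have [a0|a0] := eqVneq (a i) 0; first by rewrite (a0_Q0 _ a0) mulr0.
by rewrite mulfV // mul1r.
Qed.

Let dQ_le1 i : d i ^+ 2 * Q i i <= 1.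
Proof.
rewrite -a_sqr -exprMn /d; have [->|a0] := eqVneq (a i) 0.
  by rewrite mulr0 expr0n ler01.
by rewrite mulVf // expr1n.
Qed.

Let t_le1 i j : `|t i j| <= 1.
Proof. exact: proj_normalized_le1. Qed.

Let t_diag i : a i != 0 -> t i i = 1.
Proof. by move=> a0; rewrite /t -a_sqr -expr2 -exprMn mulVf ?expr1n. Qed.

Let t_sym i j : t i j = t j i.
Proof. by rewrite /t [Q j i]proj_sym // [d j * _]mulrC. Qed.

Let atE i j : a i * a j * t i j = Q i j.
Proof.
rewrite -[RHS]adQ [X in _ = _ * X]proj_sym // -[X in _ = _ * X]adQ.
by rewrite /t [Q j i]proj_sym //; ring.
Qed.

Let normQ i j : a i * a j * `|t i j| = `|Q i j|.
Proof. by rewrite -[in RHS]atE [RHS]normrM (ger0_norm (mulr_ge0 (a_ge0 _) (a_ge0 _))). Qed.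

(* Moments of the cosines for the weights a, and the total weight. *)
Let wsum f := \sum_i \sum_j a i * a j * f (t i j).
Let A := \sum_i a i.

Let wsum_sqr : wsum (fun x => x ^+ 2) <= n%:R.
Proof.
apply: le_trans (proj_second_moment QT QQ dQ_le1).
rewrite le_eqVlt; apply/orP; left; apply/eqP.
apply: eq_bigr => i _; apply: eq_bigr => j _.
rewrite expr2 mulrA atE /t; ring.
Qed.

Let wsum_pow4 : 3 * A ^+ 2 <= r%:R * (r%:R + 2) * wsum (fun x => x ^+ 4).
Proof.
have trQ : \tr Q = r%:R by rewrite mxtrace_idempotent // Qr.
have := @proj_fourth_moment _ _ Q QT QQ (fun i => a i * d i ^+ 4).
rewrite trQ ltr0n (leq_trans _ r4) // => /(_ isT).
have -> : \sum_i a i * d i ^+ 4 * Q i i ^+ 2 = A.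
  apply: eq_bigr => i _; rewrite -a_sqr.
  rewrite (_ : _ * _ = (a i * d i) ^+ 4 * a i); last by ring.
  rewrite /d; have [->|a0] := eqVneq (a i) 0; first by rewrite mulr0.
  by rewrite mulfV // expr1n mul1r.
congr (_ <= _ * _); apply: eq_bigr => i _; apply: eq_bigr => j _.
by rewrite /t; ring.
Qed.

Let A_sqr_le : A ^+ 2 <= n%:R * r%:R.
Proof.
have trQ : \sum_i a i ^+ 2 = r%:R.
  rewrite -Qr -mxtrace_idempotent //; apply: eq_bigr => i _; exact: a_sqr.
have S1 : \sum_(i < n) \sum_j a j ^+ 2 = n%:R * r%:R.
  by rewrite trQ sumr_const card_ord [RHS]mulr_natl.
have S2 : \sum_i \sum_(j < n) a i ^+ 2 = n%:R * r%:R by rewrite exchange_big.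
suff : A ^+ 2 * 2 <= n%:R * r%:R + n%:R * r%:R by lra.
rewrite -{1}S2 -S1 -big_split expr2 !mulr_suml; apply: ler_sum => i _ /=.
rewrite -big_split mulr_sumr mulr_suml; apply: ler_sum => j _ /=.
by have := sqr_ge0 (a i - a j); lra.
Qed.

Let wsum_split (c : R) :
  2 * c * (1 + c) ^+ 2 * wsum (fun x => `|x|) =
  - wsum (fun x => x ^+ 4) + (1 + 2 * c + 3 * c ^+ 2) * wsum (fun x => x ^+ 2)
  + c ^+ 2 * (1 + 2 * c) * A ^+ 2 - wsum (defect c).
Proof.
rewrite [A ^+ 2]expr2 mulr_suml !mulr_sumr -!sumrN -!big_split; apply: eq_bigr => i _ /=.
rewrite !mulr_sumr -!sumrN -!big_split; apply: eq_bigr => j _ /=.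
rewrite mulrCA defectE; ring.
Qed.

Lemma orthoproj_l1norm_le :
  l1norm Q <=
  ((r%:R + Num.sqrt (r%:R + 2)) / (1 + Num.sqrt (r%:R + 2))
   - r%:R / (2 * (2 * r%:R) ^+ (4 * r + 8))) * n%:R.
Proof.
have [eta [eta0 eta_u eta_le eps_le]] := @gap_constants R r r4.
have r0 : 0 < r%:R :> R by rewrite ltr0n (leq_trans _ r4).
have eps0 : 0 < r%:R / (2 * (2 * r%:R) ^+ (4 * r + 8)) :> R.
  by rewrite divr_gt0 ?mulr_gt0 ?exprn_gt0 ?mulr_gt0.
move: eps_le eps0; set eps := r%:R / (2 * _); move: eps => eps eps_le eps0.
set y : R := r%:R in eta_u eta_le r0 *.
set s := Num.sqrt _; set c := s^-1.
have y4 : 4 <= y by rewrite (ler_nat _ 4).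
have eps_small := gap_le_rank y4 eta0 eta_le eps_le.
have s0 : 0 < s by rewrite sqrtr_gt0; lra.
have s2 : s ^+ 2 = y + 2 by rewrite sqr_sqrtr //; lra.
have c0 : 0 < c by rewrite invr_gt0.
have cy : c ^+ 2 * (y + 2) = 1 by rewrite -s2 -exprMn mulVf ?expr1n // gt_eqF.
have c6 : 6 * c ^+ 2 <= 1.
  by rewrite -cy mulrC ler_pM2l ?exprn_gt0 //; lra.
have n0 : 0 < n%:R :> R.
  by rewrite ltr0n (leq_trans _ (rank_leq_row Q)) // Qr (leq_trans _ r4).
have eta_lt : eta < c.
  have : c ^+ 2 <= c by rewrite expr2 ler_piMl ?ltW //; nra.
  apply: lt_le_trans; rewrite -(@ltr_pM2r _ (y + 2)); last by lra.
  have : 0 <= eta * (y - 2) by rewrite mulr_ge0 ?(ltW eta0) //; lra.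
  by rewrite cy; lra.
(* Diagonal pairs are counted as bad, so that the relation is reflexive even at the
   indices where t i i = 0. *)
pose bad i j := (i == j) || (eta < `| `|t i j| - c |).
rewrite leNgt; apply/negP => Lgt.
pose B := \sum_(i in [set: 'I_n]) \sum_(j in [set: 'I_n] | bad i j) a i * a j.
have B_le : B <= 3 / (2 * (1 - c ^+ 2)) *
    (wsum (fun x => x ^+ 2) - c ^+ 2 * A ^+ 2 + 2 * c * eta * A ^+ 2)
    + 5 / eta ^+ 2 * wsum (defect c).
  have -> : B = \sum_i \sum_j a i * a j * (bad i j)%:R.
    rewrite /B; apply: eq_big => [i|i _]; first by rewrite inE.
    rewrite big_mkcondr /=; apply: eq_big => [j|j _]; first by rewrite inE.
    by case: (bad i j); rewrite ?mulr1 ?mulr0.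
  set al := 3 / _.
  apply: (@le_trans _ _ (\sum_i \sum_j a i * a j *
     (al * (t i j ^+ 2 - c ^+ 2 + 2 * c * eta) + 5 / eta ^+ 2 * defect c (t i j)))).
    apply: ler_sum => i _; apply: ler_sum => j _.
    have [->|ai0] := eqVneq (a i) 0; first by rewrite !mul0r.
    rewrite ler_wpM2l ?mulr_ge0 //.
    have := off_angle_le c0 c6 eta0 (t_le1 i j); congr (_%:R <= _).
    rewrite /bad; case: eqVneq => //= <-.
    rewrite t_diag // normr1 ger0_norm; last by nra.
    by rewrite (_ : eta < 1 - c) //; nra.
  rewrite le_eqVlt; apply/orP; left; apply/eqP.
  have -> : A ^+ 2 = wsum (fun=> 1).
    rewrite expr2 mulr_suml; apply: eq_bigr => i _.
    by rewrite mulr_sumr; apply: eq_bigr => j _; rewrite mulr1.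
  rewrite [RHS](_ : _ = al * wsum (fun x => x ^+ 2) +
    al * (2 * c * eta - c ^+ 2) * wsum (fun=> 1) + 5 / eta ^+ 2 * wsum (defect c)).
    rewrite /wsum !mulr_sumr -!big_split; apply: eq_bigr => i _ /=.
    rewrite !mulr_sumr -!big_split; apply: eq_bigr => j _ /=; ring.
  by ring.
have defect_nneg : 0 <= wsum (defect c).
  do 2 (apply: sumr_ge0 => ? _); apply: mulr_ge0; first exact: mulr_ge0.
  exact: defect_ge0 (ltW c0) (t_le1 _ _).
have BW : y * B < A ^+ 2.
  have [|MH_lt A2_ge] := near_extremal_estimates y4 c0 cy eps_small eps0 n0
      (sqr_ge0 A) wsum_sqr wsum_pow4 A_sqr_le defect_nneg (wsum_split c).
    rewrite /c invrK; move: Lgt; congr (_ < _).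
    by apply: eq_bigr => i _; apply: eq_bigr => j _; rewrite normQ.
  exact: off_angle_weight_lt y4 c0 cy eta0 eta_le eps_le n0 wsum_sqr (ltW MH_lt)
    A2_ge B_le.
have bad_sym : symmetric bad.
  by move=> i j; rewrite /bad eq_sym t_sym.
have badxx : reflexive bad by move=> i; rewrite /bad eqxx.
have AE : \sum_(i in [set: 'I_n]) a i = A by apply: eq_bigl => i; rewrite inE.
have A_gt0 : 0 < \sum_(i in [set: 'I_n]) a i.
  rewrite AE lt_neqAle sumr_ge0 // andbT; apply/eqP => A0.
  have B0 : 0 <= B by do 2 (apply: sumr_ge0 => ? _); rewrite mulr_ge0.
  have : y * 0 <= y * B by rewrite ler_wpM2l //; lra.
  by move: BW; rewrite -A0 expr0n /=; lra.
rewrite -AE in BW.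
have [C [_ cC goodC]] := weighted_turan a_ge0 badxx bad_sym A_gt0 BW.
(* r + 1 indices with cosines close to c in absolute value; their Gram matrix is
   singular because the rank is r. *)
pose f k := enum_val (cast_ord (esym cC) k).
have f_good k l : k != l -> `| `|t (f k) (f l)| - c| <= eta.
  move=> kl; have : ~~ bad (f k) (f l).
    apply: goodC; rewrite ?enum_valP //.
    by apply: contra kl => /eqP/enum_val_inj/cast_ord_inj->.
  by rewrite /bad negb_or -leNgt => /andP[].
have tf1 k : t (f k) (f k) = 1.
  have [l kl] : exists l, k != l.
    have [->|k0] := eqVneq k ord0; last by exists ord0.
    by exists ord_max; rewrite -val_eqE /= eq_sym -lt0n (leq_trans _ r4).
  apply: t_diag; apply/eqP => a0; have := f_good _ _ kl.
  rewrite /t /d a0 invr0 !mul0r normr0 sub0r normrN gtr0_norm //.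
  by rewrite leNgt eta_lt.
pose N : 'M[R]_n := \matrix_(i, j) t i j.
have N_rank : (\rank N < r.+1)%N.
  have -> : N = diag_mx (\row_i d i) *m Q *m diag_mx (\row_i d i).
    by apply/matrixP => i j; rewrite mul_mx_diag mul_diag_mx !mxE /t mulrAC.
  by rewrite ltnS -[leqRHS]Qr (leq_trans (mxrankM_maxl _ _)) ?mxrankM_maxr.
have := det_mxsub_gt_rank f N_rank.
apply/eqP; apply: (@near_equiangular_det_neq0 R r s eta) => //.
- by rewrite eta_u.
- by apply/matrixP => k l; rewrite !mxE t_sym.
- by move=> k; rewrite !mxE tf1.
- by move=> k l kl; rewrite !mxE f_good.
Qed.
End Gap.

Theorem theorem4p6 (R : realType) (r : nat) (hr4 : (4 <= r)%N)
    (hreven : ~~ odd r) (hrsq : forall m : nat, (r + 2)%N <> (m ^ 2)%N) :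
  (forall (n : nat) (Q : 'M[R]_n), orthoproj R r n Q ->
     l1norm Q <=
       ((r%:R + Num.sqrt (r%:R + 2)) / (1 + Num.sqrt (r%:R + 2))
        - r%:R / (2 * (2 * r%:R) ^+ (4 * r + 8))) * n%:R)
  /\ (gamma R r <=
       ((r%:R + Num.sqrt (r%:R + 2)) / (1 + Num.sqrt (r%:R + 2))
        - r%:R / (2 * (2 * r%:R) ^+ (4 * r + 8)))%:E)%E.
Proof.
set b := _ - _.
have l1norm_le (n : nat) (Q : 'M[R]_n) : orthoproj R r n Q -> l1norm Q <= b * n%:R.
  by move=> [QT QQ Qr]; apply: orthoproj_l1norm_le.
split=> //; apply: ge_ereal_sup => _ [N /= rN <-].
have N0 : 0 < N%:R :> R by rewrite ltr0n (leq_trans _ rN) // (leq_trans _ hr4).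
apply: (@le_trans _ _ ((N%:R^-1)%:E * (b * N%:R)%:E)%E).
  apply: lee_wpmul2l; first by rewrite lee_fin invr_ge0 ltW.
  by apply: ge_ereal_sup => _ [Q hQ <-]; rewrite lee_fin l1norm_le.
by rewrite -EFinM lee_fin mulrCA mulVf ?mulr1 // gt_eqF.
Qed.
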